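(* For $n \ge 3$, $Z(L(W_{1,n})) = n+1$, where $W_{1,n} = C_n + K_1$ is the wheel graph.
   Context: $W_{1,n} = C_n + K_1$ is the join of the cycle $C_n$ with one extra vertex adjacent to all vertices of $C_n$. $L(G)$ is the line graph of $G$ (vertex set $E(G)$, adjacency meaning sharing an endpoint). Zero forcing: each vertex of a graph $H$ is colored black or white; if a black vertex $u$ has exactly one white neighbor $w$, then $w$ becomes black (color-change rule). $S \subseteq V(H)$ is a zero forcing set if, starting with exactly $S$ black, repeated application of the rule makes every vertex black. $Z(H)$ is the minimum size of a zero forcing set of $H$. *)

(* Defs.v *)
From mathcomp Require Import all_boot.

Set Implicit Arguments.
Unset Strict Implicit.
Unset Printing Implicit Defensive.

Record sgraph := SGraph {
  vertex :> finType;
  adj : rel vertex;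
  adj_sym : symmetric adj;
  adj_irrefl : irreflexive adj
}.

Definition complete_rel (n : nat) : rel 'I_n := fun i j => i != j.

Lemma complete_sym n : symmetric (@complete_rel n).
Proof. by move=> i j; rewrite /complete_rel eq_sym. Qed.

Lemma complete_irrefl n : irreflexive (@complete_rel n).
Proof. by move=> i; rewrite /complete_rel eqxx. Qed.

Definition complete_graph (n : nat) : sgraph :=
  SGraph (@complete_sym n) (@complete_irrefl n).

(* [ordS i] is i + 1 modulo n.  The conjunct [i != j] only matters for n = 1,
   where it removes a loop; C_n has its usual meaning for n >= 3. *)
Definition cycle_rel (n : nat) : rel 'I_n :=
  fun i j => (i != j) && ((j == ordS i) || (i == ordS j)).

Lemma cycle_sym n : symmetric (@cycle_rel n).
Proof. by move=> i j; rewrite /cycle_rel eq_sym orbC. Qed.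

Lemma cycle_irrefl n : irreflexive (@cycle_rel n).
Proof. by move=> i; rewrite /cycle_rel eqxx. Qed.

Definition cycle_graph (n : nat) : sgraph :=
  SGraph (@cycle_sym n) (@cycle_irrefl n).

Section Join.
Variables G H : sgraph.

Definition join_rel : rel (G + H)%type := fun x y =>
  match x, y with
  | inl u, inl v => adj u v
  | inr u, inr v => adj u v
  | _, _ => true
  end.

Lemma join_sym : symmetric join_rel.
Proof. by move=> [x|x] [y|y] //=; rewrite adj_sym. Qed.

Lemma join_irrefl : irreflexive join_rel.
Proof. by move=> [x|x] /=; rewrite adj_irrefl. Qed.

Definition join_graph : sgraph := SGraph join_sym join_irrefl.
End Join.

Definition wheel (n : nat) : sgraph :=
  join_graph (cycle_graph n) (complete_graph 1).

Section LineGraph.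
Variable G : sgraph.

Definition edges : {set {set G}} :=
  [set e : {set G} | [exists x, exists y, adj x y && (e == [set x; y])]].

Definition line_rel : rel {e : {set G} | e \in edges} :=
  fun e f => (e != f) && (val e :&: val f != set0).

Lemma line_sym : symmetric line_rel.
Proof. by move=> e f; rewrite /line_rel eq_sym setIC. Qed.

Lemma line_irrefl : irreflexive line_rel.
Proof. by move=> e; rewrite /line_rel eqxx. Qed.

Definition line_graph : sgraph := SGraph line_sym line_irrefl.
End LineGraph.

Section ZeroForcing.
Variable H : sgraph.

(* [B] is the set of black vertices. *)
Definition forces (B : {set H}) (u w : H) : bool :=
  (u \in B) && ([set v | adj u v & v \notin B] == [set w]).

Definition color_change : rel {set H} := fun B B' =>
  [exists u, exists w, forces B u w && (B' == w |: B)].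

Definition zero_forcing (S : {set H}) : bool :=
  connect color_change S [set: H].

(* [arg min] is meaningful because its default value [set: H] is zero forcing
   (by [connect0]). *)
Definition zero_forcing_number : nat :=
  #|[arg min_(S < [set: H] | zero_forcing S) #|S|]|.
End ZeroForcing.

(* Main.v *)
Require Import Defs.
From mathcomp Require Import all_boot.
From mathcomp Require Import zify.

Set Implicit Arguments.
Unset Strict Implicit.
Unset Printing Implicit Defensive.

(** Write [s_i] for the spokes and [r_i] for the rim edges.  The spokes together
    with [r_0] force [r_1], [r_2], ... in turn, the edge [r_(i+1)] being forced
    by [s_(i+1)].

    For the lower bound, let [F] be the set of rim edges that have forced as long
    as no spoke has, so that the black set [B] has [#|S| + #|F|] elements and every
    neighbour of [F] is black.  A white vertex has two rim neighbours, so some rim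
    edge never gets into [F]; hence [#|F| < n], and [#|S| > n] if all vertices
    become black in this way.  If some [s_i] is about to force, then [B] contains
    [n + 1] vertices outside [F]: either [n] spokes and a rim edge next to a white
    one, or [n - 1] spokes and the two ends of the arcs of [F] met when walking
    from [s_i] in both directions towards the white spoke. *)

(** * Invariants along color changes, and general facts on zero forcing *)

Lemma connect_ind (T : finType) (e : rel T) (P : T -> Prop) (x y : T) :
  (forall a b, P a -> e a b -> P b) -> connect e x y -> P x -> P y.
Proof.
move=> Pe /connectP [p]; elim: p x => [|z p IHp] x /= => [_ -> //|].
by move=> /andP [exz pz] y_last /Pe /(_ exz); apply: IHp.
Qed.

Section ZeroForcingFacts.
Variable H : sgraph.
Implicit Types (B F S : {set H}) (u v w : H).

Lemma forcesP B u w :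
  reflect [/\ u \in B, w \notin B, adj u w &
              forall v, adj u v -> v != w -> v \in B] (forces B u w).
Proof.
apply: (iffP andP) => [[uB /eqP/setP Bw]|[uB wB uw uN]]; split=> //.
- by have := Bw w; rewrite !inE eqxx => /andP [].
- by have := Bw w; rewrite !inE eqxx => /andP [].
- move=> v uv; apply: contraNT => vB.
  by have := Bw v; rewrite !inE uv vB /= => <-.
- apply/eqP/setP=> v; rewrite !inE.
  have [->|vw] := eqVneq v w; first by rewrite uw wB.
  by apply/negbTE/nandP; case: (boolP (adj u v)) => [/uN ->//|]; [right|left].
Qed.

(** As long as the walk stays in [F], its next vertex is black; so its first vertex outside [F],
    which exists because the end is one, is black. *)
Lemma exists_boundary_on_walk B F (f : nat -> H) m :
  (forall u v, u \in F -> adj u v -> v \in B) ->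
  (forall k, k < m -> adj (f k) (f k.+1)) ->
  f 0 \in B -> f m \notin F -> exists2 k, k <= m & f k \in B :\: F.
Proof.
move=> FB; elim: m f => [|m IHm] f fadj f0 fm.
  by exists 0; rewrite // inE fm.
have [f0F|f0F] := boolP (f 0 \in F); last by exists 0; rewrite // inE f0F.
have [|||k km kB] := IHm (f \o succn) => //=.
- by move=> k km; apply: fadj.
- exact: FB f0F (fadj 0 _).
- by exists k.+1.
Qed.

Lemma zero_forcing_number_eq m :
  (exists2 S : {set H}, zero_forcing S & #|S| = m) ->
  (forall S : {set H}, zero_forcing S -> m <= #|S|) -> zero_forcing_number H = m.
Proof.
move=> [S0 zf0 <-] lb; rewrite /zero_forcing_number.
case: arg_minnP => [|S zfS Smin]; first exact: connect0.
by apply/eqP; rewrite eqn_leq Smin // lb.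
Qed.

End ZeroForcingFacts.

Lemma adj_line_graphP (G : sgraph) (e f : line_graph G) :
  reflect (e != f /\ exists2 x, x \in val e & x \in val f) (adj e f).
Proof.
apply: (iffP andP) => [[ef /set0Pn [x /setIP [xe xf]]]|[ef [x xe xf]]]; split=> //.
  by exists x.
by apply/set0Pn; exists x; apply/setIP.
Qed.

(** * Edges of the wheel and their adjacencies in the line graph *)

Section Wheel.
Variable n : nat.
Hypothesis n_ge3 : 3 <= n.
Implicit Types i j : 'I_n.

Notation LW := (line_graph (wheel n)).

Let rv i : wheel n := inl i.
Let hub : wheel n := inr ord0.

Lemma val_ordS i : ordS i = (if i.+1 == n then 0 else i.+1) :> nat.
Proof.
rewrite /=; case: eqP => [->|iS]; first by rewrite modnn.
by rewrite modn_small //; have := ltn_ord i; lia.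
Qed.

Lemma ordS_neq i : i != ordS i.
Proof. by rewrite -val_eqE [val (ordS i)]val_ordS /=; case: ifP; lia. Qed.

(** Fails for [n = 2], where both rim edges would join the same two vertices. It makes [rim]
    injective and the two rim neighbours of a rim edge distinct. *)
Lemma ordSS_neq i : i != ordS (ordS i).
Proof.
rewrite -val_eqE [val (ordS _)]val_ordS [nat_of_ord (ordS i)]val_ordS /=.
by case: ifP; case: ifP; lia.
Qed.

Lemma spoke_edge i : [set rv i; hub] \in edges (wheel n).
Proof.
by rewrite inE; apply/existsP; exists (rv i); apply/existsP; exists hub => /=.
Qed.

Lemma rim_edge i : [set rv i; rv (ordS i)] \in edges (wheel n).
Proof.
rewrite inE; apply/existsP; exists (rv i); apply/existsP; exists (rv (ordS i)).
by rewrite eqxx andbT /= /cycle_rel eqxx ordS_neq.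
Qed.

Definition spoke i : LW := exist (fun e => e \in edges (wheel n)) _ (spoke_edge i).
Definition rim i : LW := exist (fun e => e \in edges (wheel n)) _ (rim_edge i).

Lemma in_spoke i x : (x \in val (spoke i)) = (x == rv i) || (x == hub).
Proof. by rewrite !inE. Qed.

Lemma in_rim i x : (x \in val (rim i)) = (x == rv i) || (x == rv (ordS i)).
Proof. by rewrite !inE. Qed.

Lemma spoke_inj : injective spoke.
Proof.
move=> i j ij; have : rv i \in val (spoke i) by rewrite in_spoke eqxx.
by rewrite ij in_spoke orbF => /eqP [].
Qed.

Lemma spoke_neq_rim i j : spoke i != rim j.
Proof.
apply/eqP => ij; have : hub \in val (spoke i) by rewrite in_spoke eqxx orbT.
by rewrite ij in_rim.
Qed.

Let rv_inj : injective rv.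
Proof. by move=> i j []. Qed.

Lemma rim_inj : injective rim.
Proof.
move=> i j ij; have : rv i \in val (rim i) by rewrite in_rim eqxx.
have : rv (ordS i) \in val (rim i) by rewrite in_rim eqxx orbT.
rewrite ij !in_rim => /orP [] /eqP/rv_inj Si; last first.
  by have := can_inj (@ordSK n) Si.
(* Here the endpoints are matched crosswise, [ordS i = j] and [i = ordS j], so two steps along the
   cycle would lead back to [j]. *)
case/orP=> /eqP/rv_inj // iS; by have := ordSS_neq j; rewrite -iS Si eqxx.
Qed.

Lemma wheel_edgeP (e : LW) : (exists i, e = spoke i) \/ (exists i, e = rim i).
Proof.
have := valP e; rewrite inE => /existsP [[x|x]] /existsP [[y|y]] /andP [] //=.
- case/andP=> _ /orP [] /eqP -> /eqP ev; right.
    by exists x; apply: val_inj.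
  by exists y; apply: val_inj; rewrite /= ev setUC.
- move=> _ /eqP ev; left; exists x; apply: val_inj.
  by rewrite /= ev (ord1 y).
- move=> _ /eqP ev; left; exists y; apply: val_inj.
  by rewrite /= ev (ord1 x) setUC.
- by rewrite /complete_rel (ord1 x) (ord1 y).
Qed.

Lemma adj_spokes i j : adj (spoke i) (spoke j) = (i != j).
Proof.
apply/adj_line_graphP/idP => [[+ _]|ij]; first by apply: contraNneq => ->.
split; first by rewrite (inj_eq spoke_inj).
by exists hub; rewrite in_spoke eqxx orbT.
Qed.

Lemma adj_spoke_rim i j : adj (spoke i) (rim j) = (i == j) || (i == ordS j).
Proof.
apply/adj_line_graphP/orP => [[_ [x]]|ij].
  by rewrite in_spoke in_rim => /orP [] /eqP -> // /orP [] /eqP/rv_inj ->; [left|right].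
split; first exact: spoke_neq_rim.
exists (rv i); first by rewrite in_spoke eqxx.
by rewrite in_rim; case: ij => /eqP ->; rewrite eqxx ?orbT.
Qed.

Lemma adj_rim_ordS i : adj (rim i) (rim (ordS i)).
Proof.
apply/adj_line_graphP; split; first by rewrite (inj_eq rim_inj) ordS_neq.
by exists (rv (ordS i)); rewrite in_rim eqxx ?orbT.
Qed.

Definition spokes : {set LW} := [set spoke i | i : 'I_n].
Definition rims : {set LW} := [set rim i | i : 'I_n].

Lemma card_spokes : #|spokes| = n.
Proof. by rewrite card_imset ?card_ord //; apply: spoke_inj. Qed.

Lemma card_rims : #|rims| = n.
Proof. by rewrite card_imset ?card_ord //; apply: rim_inj. Qed.

Lemma mem_spokes i : spoke i \in spokes. Proof. exact: imset_f. Qed.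

Lemma mem_rims i : rim i \in rims. Proof. exact: imset_f. Qed.

Lemma rim_notin_spokes i : rim i \notin spokes.
Proof. by apply/imsetP => -[j _ /esym/eqP]; rewrite (negbTE (spoke_neq_rim j i)). Qed.

Lemma spoke_notin_rims i : spoke i \notin rims.
Proof. by apply/imsetP => -[j _ /eqP]; rewrite (negbTE (spoke_neq_rim i j)). Qed.

Lemma setU_spokes_rims : spokes :|: rims = [set: LW].
Proof.
apply/setP=> e; rewrite !inE.
by case: (wheel_edgeP e) => -[i ->]; rewrite ?mem_spokes ?mem_rims ?orbT.
Qed.

Lemma disjoint_spokes_rims : [disjoint spokes & rims].
Proof.
rewrite disjoint_subset; apply/subsetP => _ /imsetP [i _ ->].
exact: spoke_notin_rims.
Qed.

Lemma card_line_wheel : #|[set: LW]| = n + n.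
Proof.
rewrite -setU_spokes_rims cardsU card_spokes card_rims.
by move: disjoint_spokes_rims; rewrite -setI_eq0 => /eqP ->; rewrite cards0 subn0.
Qed.

(** * Upper bound: a zero forcing set of [n + 1] edges *)

Definition spokes_rims_upto k : {set LW} :=
  spokes :|: [set rim i | i : 'I_n & i <= k].

Lemma mem_spokes_rims_upto_rim k i : (rim i \in spokes_rims_upto k) = (i <= k).
Proof.
rewrite inE (negbTE (rim_notin_spokes i)) /=.
by rewrite (mem_imset _ _ rim_inj) inE.
Qed.

Lemma mem_spokes_rims_upto_spoke k i : spoke i \in spokes_rims_upto k.
Proof. by rewrite inE mem_spokes. Qed.

Lemma spokes_rims_uptoS k : k.+1 < n ->
  color_change (spokes_rims_upto k) (spokes_rims_upto k.+1).
Proof.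
move=> kn; pose i := Ordinal kn; apply/existsP; exists (spoke i).
apply/existsP; exists (rim i); apply/andP; split.
  apply/forcesP; split.
  - exact: mem_spokes_rims_upto_spoke.
  - by rewrite mem_spokes_rims_upto_rim ltnn.
  - by rewrite adj_spoke_rim eqxx.
  - move=> v; case: (wheel_edgeP v) => -[j ->].
      by rewrite mem_spokes_rims_upto_spoke.
    (* The index [k.+1] of [i] is not 0, so [i = ordS j] does not wrap around: the only other rim
       neighbour of [spoke i] has index [k], and is black. *)
    rewrite adj_spoke_rim (inj_eq rim_inj) mem_spokes_rims_upto_rim.
    by rewrite -!val_eqE [val (ordS j)]val_ordS /=; case: ifP; lia.
apply/eqP/setP => v; rewrite in_setU1; case: (wheel_edgeP v) => -[j ->].
  by rewrite !mem_spokes_rims_upto_spoke orbT.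
by rewrite (inj_eq rim_inj) !mem_spokes_rims_upto_rim -val_eqE /=; lia.
Qed.

Lemma zero_forcing_spokes_rim0 : zero_forcing (spokes_rims_upto 0).
Proof.
rewrite /zero_forcing; have -> : [set: LW] = spokes_rims_upto n.-1.
  apply/setP => v; rewrite in_setT; case: (wheel_edgeP v) => -[i ->].
    by rewrite mem_spokes_rims_upto_spoke.
  by rewrite mem_spokes_rims_upto_rim; have := ltn_ord i; lia.
have : n.-1 < n by lia.
elim: n.-1 => [|k IHk] kn; first exact: connect0.
apply: connect_trans (IHk _) (connect1 _); first by lia.
exact: spokes_rims_uptoS.
Qed.

Lemma card_spokes_rim0 : #|spokes_rims_upto 0| = n + 1.
Proof.
have n_gt0 : 0 < n by lia.
have -> : spokes_rims_upto 0 = rim (Ordinal n_gt0) |: spokes.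
  apply/setP => v; rewrite in_setU1; case: (wheel_edgeP v) => -[i ->].
    by rewrite mem_spokes_rims_upto_spoke mem_spokes orbT.
  rewrite mem_spokes_rims_upto_rim (negbTE (rim_notin_spokes i)) orbF.
  by rewrite (inj_eq rim_inj) -val_eqE leqn0.
by rewrite cardsU1 rim_notin_spokes card_spokes addnC.
Qed.

(** * Lower bound *)

(** Every vertex of the line graph has two rim neighbours. When [u] forces [w], the one found here
    is a rim edge that has not forced yet. *)
Lemma exists_other_rim_neighbor u w : exists2 i, rim i != u & adj (rim i) w.
Proof.
suff [i [j [ij iw jw]]] : exists i j, [/\ i != j, adj (rim i) w & adj (rim j) w].
  have [iu|] := eqVneq (rim i) u; last by exists i.
  by exists j; rewrite // -iu (inj_eq rim_inj) eq_sym.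
case: (wheel_edgeP w) => -[k ->]; exists (ord_pred k).
  exists k; split.
  - by have := ordS_neq (ord_pred k); rewrite ord_predK.
  - by rewrite adj_sym adj_spoke_rim ord_predK eqxx orbT.
  - by rewrite adj_sym adj_spoke_rim eqxx.
exists (ordS k); split.
- by have := ordSS_neq (ord_pred k); rewrite ord_predK.
- by have := adj_rim_ordS (ord_pred k); rewrite ord_predK.
- by rewrite adj_sym adj_rim_ordS.
Qed.

Lemma val_iter_ordS k i : val (iter k (@ordS n) i) = (i + k) %% n.
Proof.
elim: k => [|k IHk] /=; first by rewrite addn0 modn_small.
by rewrite [nat_of_ord _]IHk -addn1 modnDml addn1 addnS.
Qed.

Lemma iter_ordS_inj i k l :
  k < n -> l < n -> iter k (@ordS n) i = iter l (@ordS n) i -> k = l.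
Proof.
move=> kn ln /(congr1 val); rewrite !val_iter_ordS => /eqP.
by rewrite eqn_modDl !modn_small // => /eqP.
Qed.

Lemma iter_ordS_onto i j : exists2 d, d < n & j = iter d (@ordS n) i.
Proof.
(* This is [j - i] modulo [n], arranged so that the subtraction does not truncate. *)
exists ((j + (n - i)) %% n); first by rewrite ltn_mod; lia.
apply: val_inj; rewrite val_iter_ordS modnDmr.
have := ltn_ord i; have := ltn_ord j => jn iin.
by rewrite (_ : i + _ = j + n) ?modnDr ?modn_small //; lia.
Qed.

(* The two walks start at the two rim neighbours of [spoke i] and end at the two
   rim neighbours of [spoke j]; together they cover each rim edge once. *)
Lemma two_boundary_rims (B F : {set LW}) i j : i != j ->
  (forall u v, u \in F -> adj u v -> v \in B) -> spoke j \notin B ->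
  rim i \in B -> rim (ord_pred i) \in B ->
  exists k l, [/\ k != l, rim k \in B :\: F & rim l \in B :\: F].
Proof.
move=> ij FB jB iB piB; have [d dn jE] := iter_ordS_onto i j.
have d_gt0 : 0 < d by case: d jE {dn} => // jE; rewrite jE eqxx in ij.
pose c k := iter k (@ordS n) i.
have cS k : adj (rim (c k)) (rim (c k.+1)) by apply: adj_rim_ordS.
have notF k : adj (rim k) (spoke j) -> rim k \notin F.
  by move=> kj; apply: contra jB => kF; apply: FB kF kj.
(* Forward walk, from [c 0 = i] to [c d.-1], the predecessor of [j]. *)
have [||k kd kBF] :=
  @exists_boundary_on_walk _ B F (fun k => rim (c k)) d.-1 FB (fun k _ => cS k) => //.
  by apply: notF; rewrite adj_sym adj_spoke_rim -[ordS _]iterS prednK // -jE eqxx orbT.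
(* Backward walk, from [c n.-1 = ord_pred i] down to [c d = j]. *)
have [|||l ld lBF] :=
  @exists_boundary_on_walk _ B F (fun k => rim (c (n.-1 - k))) (n.-1 - d) FB => //.
- move=> m md; rewrite adj_sym.
  by have := cS (n.-1 - m.+1); rewrite subnSK //; lia.
- rewrite subn0 (_ : c _ = ord_pred i) //; apply: (can_inj (@ordSK n)).
  rewrite ord_predK -[ordS _]iterS prednK; last by lia.
  by apply: val_inj; rewrite val_iter_ordS modnDr modn_small.
- by apply: notF; rewrite adj_sym adj_spoke_rim subKn; [rewrite -[c d]jE eqxx | lia].
exists (c k), (c (n.-1 - l)); split => //.
(* The forward walk uses positions below [d], the backward one positions from [d] to [n.-1]. *)
by apply/eqP => /iter_ordS_inj; lia.
Qed.

Lemma card_black_at_spoke_force (B F : {set LW}) i w :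
  F \subset rims -> (forall u v, u \in F -> adj u v -> v \in B) ->
  forces B (spoke i) w -> n < #|B :\: F|.
Proof.
move=> Frims FB /forcesP [iB wB iw iN].
have spokeF j : spoke j \notin F.
  by apply: contra (spoke_notin_rims j); apply: (subsetP Frims).
(* The spokes form a clique, so a forcing spoke sees every other spoke. *)
have spokeB j : spoke j != w -> spoke j \in B :\: F.
  move=> jw; rewrite inE spokeF /=; have [-> //|ij] := eqVneq j i.
  by apply: iN; rewrite // adj_spokes eq_sym.
case: (wheel_edgeP w) => -[j wE]; subst w.
- have ij : i != j by rewrite adj_spokes in iw.
  have rimB k : adj (spoke i) (rim k) -> rim k \in B.
    by move=> ik; apply: iN; rewrite // eq_sym spoke_neq_rim.
  have [||k [l [kl kBF lBF]]] := two_boundary_rims ij FB wB.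
  + by apply: rimB; rewrite adj_spoke_rim eqxx.
  + by apply: rimB; rewrite adj_spoke_rim ord_predK eqxx orbT.
  have sub : rim k |: (rim l |: spokes :\ spoke j) \subset B :\: F.
    rewrite !subUset !sub1set kBF lBF /=; apply/subsetP => v.
    by rewrite in_setD1 => /andP [vj /imsetP [m _ vE]]; subst v; apply: spokeB.
  apply: leq_trans (subset_leq_card sub).
  rewrite !cardsU1 !inE !(negbTE (rim_notin_spokes _)) !andbF !orbF.
  rewrite (inj_eq rim_inj) kl.
  by have := cardsD1 (spoke j) spokes; rewrite mem_spokes card_spokes; lia.
(* [rim k] is the other rim edge at the rim end of [spoke i]. It is black because [spoke i] forces
   only [w], and outside [F] because it is adjacent to the white [w]. *)
- have [k ik kj] : exists2 k, adj (spoke i) (rim k) & adj (rim k) (rim j).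
    rewrite adj_spoke_rim in iw; case/orP: iw => /eqP ->.
      exists (ord_pred j); first by rewrite adj_spoke_rim ord_predK eqxx orbT.
      by have := adj_rim_ordS (ord_pred j); rewrite ord_predK.
    exists (ordS j); first by rewrite adj_spoke_rim eqxx.
    by rewrite adj_sym adj_rim_ordS.
  have kBF : rim k \in B :\: F.
    rewrite inE; apply/andP; split.
      by apply: contra wB => kF; apply: FB kF kj.
    by apply: iN => //; apply: contraTneq kj => ->; rewrite adj_irrefl.
  have sub : rim k |: spokes \subset B :\: F.
    rewrite subUset sub1set kBF; apply/subsetP => _ /imsetP [l _ ->].
    exact/spokeB/spoke_neq_rim.
  apply: leq_trans (subset_leq_card sub).
  by rewrite cardsU1 rim_notin_spokes card_spokes.
Qed.

Lemma card_zero_forcing_line_wheel (S : {set LW}) : zero_forcing S -> n < #|S|.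
Proof.
(* The left alternative is reached at the first force by a spoke and then persists. Before that, [F]
   collects the rim edges that have forced. *)
pose P (B : {set LW}) := n < #|S| \/ exists F : {set LW},
  [/\ F \subset rims, F \subset B, #|F| < n, #|B| = #|S| + #|F| &
      forall u v, u \in F -> adj u v -> v \in B].
move=> zfS; suff : P [set: LW].
  by case=> // -[F [_ _ Fn + _]]; rewrite card_line_wheel; lia.
apply: (connect_ind _ zfS) => [B B'|]; last first.
  right; exists set0; split; rewrite ?sub0set ?cards0 ?addn0 //; first by lia.
  by move=> u v; rewrite inE.
case=> [|[F [Frims FsubB Fn cardB FB]]]; first by left.
move=> /existsP [u /existsP [w /andP [uw /eqP ->]]].
case: (wheel_edgeP u) => -[i uE]; subst u.
  (* Since [F] lies in [B], the set [B :\: F] has [#|B| - #|F| = #|S|] elements. *)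
  left; have := card_black_at_spoke_force Frims FB uw.
  by have := cardsID F B; rewrite (setIidPr FsubB); lia.
case/forcesP: uw => iB wB iw iN; right.
have notF k : adj (rim k) w -> rim k \notin F.
  by move=> kw; apply: contra wB => kF; apply: FB kF kw.
have [j ji jw] := exists_other_rim_neighbor (rim i) w.
exists (rim i |: F); split.
- by rewrite subUset sub1set mem_rims.
- by rewrite subUset sub1set in_setU1 iB orbT subsetU // FsubB orbT.
(* The bound stays strict: [rim j] is adjacent to [w], still white, so it lies outside [F], and it
   differs from [rim i]. *)
- rewrite -[ltnRHS]card_rims; apply: proper_card; apply/properP; split.
    by rewrite subUset sub1set mem_rims.
  by exists (rim j); rewrite ?mem_rims // in_setU1 negb_or ji notF.
(* For the same reason [rim i] is new in [F], so that [B] and [F] both grow by one. *)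
- by rewrite !cardsU1 wB notF // cardB; lia.
- move=> u v; rewrite !in_setU1 => /orP [/eqP ->|uF] uv.
    by have [//|/(iN v uv) ->] := eqVneq v w.
  by rewrite (FB u) ?orbT.
Qed.

End Wheel.

Theorem theorem3p17 (n : nat) (hn : 3 <= n) :
  zero_forcing_number (line_graph (wheel n)) = n + 1.
Proof.
apply: zero_forcing_number_eq.
  by exists (spokes_rims_upto hn 0);
    [apply: zero_forcing_spokes_rim0 | apply: card_spokes_rim0].
by move=> S /(card_zero_forcing_line_wheel hn); rewrite addn1.
Qed.
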